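(* Let $X,Y$ be real Banach spaces and let $\mathcal{I},\mathcal{J}$ be ideals on $\omega$ such that $\mathcal{I}$ is tall. Then a matrix $A=(A_{n,k}:n,k\in\omega)$ of linear operators in $\mathcal{L}(X,Y)$ belongs to $(c(X,\mathcal{I}),c_0^b(Y,\mathcal{J}))$ if and only if there exists $k_1\in\omega$ such that: (B1) $A_{n,k}=0$ for all $n\in\omega$ and $k\ge k_1$; (B2) $\sup_n\|A_{n,k}x\|<\infty$ for all $x\in X$ and $k<k_1$; (B3) $\mathcal{J}\text{-}\lim_nA_{n,k}=0$ for all $k<k_1$.
   Context: $\omega$ is the set of nonnegative integers. An ideal on $\omega$ is a family of subsets of $\omega$ closed under subsets and finite unions; every ideal is assumed to contain all finite sets and to differ from the power set of $\omega$. An ideal $\mathcal{I}$ is tall if every infinite $S\subseteq\omega$ has an infinite subset belonging to $\mathcal{I}$. $\mathcal{I}\text{-}\lim_nx_n=\eta$ means $\{n:x_n\notin U\}\in\mathcal{I}$ for every neighborhood $U$ of $\eta$. For a Banach space $V$, $c(V,\mathcal{I})$ is the space of $\mathcal{I}$-convergent sequences in $V$ and $c_0^b(V,\mathcal{J})$ is the space of norm-bounded sequences with $\mathcal{J}$-limit $0$. $\mathcal{L}(X,Y)$ is the space of all (not necessarily bounded) linear operators $X\to Y$, with the strong operator topology, so that $\mathcal{J}\text{-}\lim_nA_{n,k}=0$ means $\mathcal{J}\text{-}\lim_nA_{n,k}x=0$ in norm for every $x\in X$. $A\boldsymbol{x}=(A_n\boldsymbol{x})_n$, $A_n\boldsymbol{x}=\sum_kA_{n,k}x_k$,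 provided each series converges in the norm of $Y$. $A\in(\mathscr{A},\mathscr{B})$ means that $A\boldsymbol{x}$ is well defined and in $\mathscr{B}$ for every $\boldsymbol{x}\in\mathscr{A}$. *)

(* Defs.v *)
From HB Require Import structures.
From mathcomp Require Import all_boot all_order all_algebra.
From mathcomp Require Import all_classical all_reals all_analysis.

Set Implicit Arguments.
Unset Strict Implicit.
Unset Printing Implicit Defensive.

Import Order.TTheory GRing.Theory Num.Theory.
Import numFieldNormedType.Exports.

Local Open Scope classical_set_scope.
Local Open Scope ring_scope.

Record is_ideal (I : set (set nat)) : Prop := IsIdeal {
  ideal_subset : forall S T : set nat, S `<=` T -> I T -> I S ;
  ideal_setU : forall S T : set nat, I S -> I T -> I (S `|` T) ;
  ideal_finite : forall S : set nat, finite_set S -> I S ;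
  ideal_proper : I <> setT }.

Definition tall (I : set (set nat)) : Prop :=
  forall S : set nat, infinite_set S ->
    exists T : set nat, [/\ T `<=` S, infinite_set T & I T].

Definition ideal_lim (V : topologicalType) (I : set (set nat))
    (x : nat -> V) (eta : V) : Prop :=
  forall U : set V, nbhs eta U -> I [set n | ~ U (x n)].

(* No boundedness is required here, in contrast with [ideal_c0b]. *)
Definition ideal_c (R : realType) (V : completeNormedModType R)
    (I : set (set nat)) : set (nat -> V) :=
  [set x | exists eta : V, ideal_lim I x eta].

Definition ideal_c0b (R : realType) (V : completeNormedModType R)
    (J : set (set nat)) : set (nat -> V) :=
  [set x | bounded_fun x /\ ideal_lim J x 0].

(* The entries are arbitrary linear maps: no continuity is assumed. *)
Definition op_matrix (R : realType) (X Y : completeNormedModType R) : Type :=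
  nat -> nat -> {linear X -> Y}.

Definition matrix_series (R : realType) (X Y : completeNormedModType R)
    (A : op_matrix X Y) (x : nat -> X) (n : nat) : nat -> Y :=
  series (fun k => A n k (x k)).

Definition matrix_apply (R : realType) (X Y : completeNormedModType R)
    (A : op_matrix X Y) (x : nat -> X) : nat -> Y :=
  fun n => limn (matrix_series A x n).

Definition matrix_class (R : realType) (X Y : completeNormedModType R)
    (SX : set (nat -> X)) (SY : set (nat -> Y)) : set (op_matrix X Y) :=
  [set A | forall x : nat -> X, SX x ->
     (forall n, cvgn (matrix_series A x n)) /\ SY (matrix_apply A x)].

Definition strong_ideal_lim0 (R : realType) (X Y : completeNormedModType R)
    (J : set (set nat)) (T : nat -> {linear X -> Y}) : Prop :=
  forall x : X, ideal_lim J (fun n => T n x) 0.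

(* Main.v *)
Require Import Defs.
From HB Require Import structures.
From mathcomp Require Import all_boot all_order all_algebra.
From mathcomp Require Import all_classical all_reals all_analysis.

Set Implicit Arguments.
Unset Strict Implicit.
Unset Printing Implicit Defensive.

Import Order.TTheory GRing.Theory Num.Theory.
Import numFieldNormedType.Exports.

Local Open Scope classical_set_scope.
Local Open Scope ring_scope.

(** For sufficiency, the rows vanish beyond [k1], so [A_n x] is the finite sum
    of the [k1] sequences [(A_{n,k} x_k)_n], each of which is bounded and has
    [J]-limit [0]; such sequences are closed under addition
    ([matrix_class_of_columns]).

    For necessity, a sequence with a single nonzero entry is [I]-convergent
    because [I] contains the finite sets, and testing [A] on it returns a
    column; so every column is pointwise bounded with [J]-limit [0]. It remains
    to see that only finitely many columns are nonzero. If there were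
    infinitely many, tallness would yield an infinite [T] in [I] consisting of
    indices of nonzero columns. The point is that a sequence supported in [T]
    has [I]-limit [0] whatever its values on [T] are, so [A] must be defined,
    with bounded result, on all of these, with no growth condition available to
    protect it. Since a nonzero linear map takes values that overwhelm any
    given vector ([linear_shift_unbounded]), this is impossible for two
    reasons. First, no row may have infinitely many nonzero entries on [T], as
    the terms of the series could be chosen not to tend to [0]
    ([row_finite_on_support]). Second, once the rows are finite on [T], each
    row that does not vanish on [T] has a last nonzero entry there, and these
    last positions are unbounded since the columns in [T] are nonzero. Values
    [x_k] at the last positions can then be fixed one after the other, each
    making the corresponding finite sum as large as wanted, without being
    disturbed by the later ones ([gliding_hump]). *)

(** * Sequences and series *)

Lemma bounded_seqE (R : realType) (V : normedModType R) (u : nat -> V) :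
  bounded_fun u <-> exists M : R, forall n, `|u n| <= M.
Proof.
have gT : ProperFilter (globally [set: nat]).
  exact: globally_properfilter (I : setT 0%N).
split=> [/ex_bound[M uM]|[M uM]].
  by exists M => n; exact: uM.
by apply/ex_bound; exists M => n _; exact: uM.
Qed.

Lemma bounded_seq_ereal_sup (R : realType) (V : normedModType R)
    (u : nat -> V) :
  bounded_fun u <-> (ereal_sup (range (fun n => `|u n|%:E)) < +oo)%E.
Proof.
rewrite bounded_seqE; split=> [[M uM]|].
  apply: (@le_lt_trans _ _ M%:E); last exact: ltry.
  by apply: ge_ereal_sup => _ [n _ <-]; rewrite lee_fin.
case supE : (ereal_sup _) => [M| |] // _.
  exists M => n; rewrite -lee_fin -supE.
  by apply: ereal_sup_ubound; exists n.
(* The supremum of a nonempty family of reals is not -oo. *)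
have : (`|u 0%N|%:E <= -oo)%E.
  by rewrite -supE; apply: ereal_sup_ubound; exists 0%N.
by rewrite leeNy_eq.
Qed.

Lemma series_eventually_zero (R : realType) (V : normedModType R)
    (u : nat -> V) (m : nat) :
  (forall k, (m <= k)%N -> u k = 0) -> series u @ \oo --> series u m.
Proof.
move=> u0; apply: cvg_near_cst; exists m => // n /= mn.
rewrite !seriesEnat /= (big_cat_nat (leq0n m) mn) /= [X in _ + X]big_nat_cond.
by rewrite [X in _ + X]big1 ?addr0// => i /andP[/andP[/u0]].
Qed.

Lemma finite_set_natP (S : set nat) :
  finite_set S <-> exists m, forall k, S k -> (k < m)%N.
Proof.
split=> [/finite_seqP[s ->]|[m Sm]]; last exact: sub_finite_set (finite_II m).
by exists (\max_(i <- s) i).+1 => k ks; rewrite ltnS (leq_bigmax_seq _ ks).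
Qed.

Lemma infinite_set_unbounded (S : set nat) (m : nat) :
  infinite_set S -> exists2 k, S k & (m <= k)%N.
Proof.
move=> Sinf; apply: contrapT => noS; apply: Sinf.
apply/finite_set_natP; exists m => k Sk.
by rewrite ltnNge; apply/negP => mk; apply: noS; exists k.
Qed.

(** Course-of-values recursion, for an equation whose right-hand side at [k]
    depends only on the values below [k]. *)
Lemma course_of_values_rec (T : Type) (t0 : T) (F : nat -> (nat -> T) -> T) :
  (forall k g h, (forall i, (i < k)%N -> g i = h i) -> F k g = F k h) ->
  exists x : nat -> T, forall k, x k = F k x.
Proof.
move=> Floc.
(* [h k] is the prefix of length [k] of the solution, padded with [t0]. *)
pose h := fix h k := if k is k'.+1
  then fun i => if i == k' then F k' (h k') else h k' i else fun _ : nat => t0.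
have hE k i : (i < k)%N -> h k i = F i (h i).
  elim: k => //= k IH; rewrite ltnS leq_eqVlt => /predU1P[->|ik].
    by rewrite eqxx.
  by rewrite ltn_eqF// IH.
exists (fun k => F k (h k)) => k; apply: Floc => i ik.
exact: hE.
Qed.

(** * Ideal convergence *)

(** [ideal_lim I] is convergence along this dual filter, which makes the general
    theory of limits along filters applicable. *)
Definition dual_filter (I : set (set nat)) : set_system nat :=
  [set S | I (~` S)].

Lemma dual_filter_filter (I : set (set nat)) :
  is_ideal I -> Filter (dual_filter I).
Proof.
move=> hI; split; rewrite /dual_filter /=.
- by rewrite setCT; apply: (ideal_finite hI).
- by move=> P Q IP IQ; have := ideal_setU hI IP IQ; rewrite -setCI.
- by move=> P Q PQ; apply: (ideal_subset hI); exact: subsetC.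
Qed.

Lemma ideal_c_supported (R : realType) (X : completeNormedModType R)
    (I : set (set nat)) (T : set nat) (x : nat -> X) :
  is_ideal I -> I T -> (forall k, ~ T k -> x k = 0) -> ideal_c I x.
Proof.
move=> hI IT x0; exists 0 => U U0; apply: (ideal_subset hI) IT => k /= Ux.
apply: contrapT => /x0 xk0; apply: Ux; rewrite xk0.
exact: nbhs_singleton.
Qed.

Lemma ideal_c0b_sum (R : realType) (Y : completeNormedModType R)
    (J : set (set nat)) (m : nat) (u : nat -> nat -> Y) :
  is_ideal J -> (forall k, (k < m)%N -> ideal_c0b J (u k)) ->
  ideal_c0b J (fun n => \sum_(0 <= k < m) u k n).
Proof.
move=> hJ; have FJ := dual_filter_filter hJ.
elim: m => [_|m IH uJ].
  rewrite (_ : (fun n => _) = cst 0); last first.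
    by apply/funext => n; rewrite big_geq.
  split; first by apply/bounded_seqE; exists 0 => n; rewrite normr0.
  exact: (@cvg_cst _ _ _ (dual_filter J)).
have [/bounded_seqE[M sM] slim] := IH (fun k km => uJ k (ltnW km)).
have [/bounded_seqE[N uN] ulim] := uJ m (ltnSn m).
rewrite (_ : (fun n => _) = (fun n => \sum_(0 <= k < m) u k n) + u m);
  last first.
  by apply/funext => n; rewrite big_nat_recr.
split.
  apply/bounded_seqE; exists (M + N) => n.
  by apply: le_trans (ler_normD _ _) _; exact: lerD.
move: (@cvgD _ _ _ (dual_filter J) FJ _ _ _ _ slim ulim).
by rewrite addr0.
Qed.

(** * Columns of a matrix *)

Lemma matrix_series_eventually_zero (R : realType)
    (X Y : completeNormedModType R) (A : op_matrix X Y) (x : nat -> X)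
    (n m : nat) :
  (forall k, (m <= k)%N -> A n k (x k) = 0) ->
  cvgn (matrix_series A x n) /\ matrix_apply A x n = matrix_series A x n m.
Proof.
move=> /series_eventually_zero Axm; split; last exact/cvg_lim.
by apply/cvg_ex; exists (matrix_series A x n m).
Qed.

Lemma matrix_class_of_columns (R : realType) (X Y : completeNormedModType R)
    (SX : set (nat -> X)) (J : set (set nat)) (A : op_matrix X Y) (m : nat) :
  is_ideal J ->
  (forall n k, (m <= k)%N -> A n k =1 \0) ->
  (forall k v, (k < m)%N -> ideal_c0b J (fun n => A n k v)) ->
  matrix_class SX (ideal_c0b J) A.
Proof.
move=> hJ A0 AJ x _.
have Ax n := matrix_series_eventually_zero
  (fun k (mk : (m <= k)%N) => A0 n k mk (x k)).
split=> [n|]; first by case: (Ax n).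
rewrite (_ : matrix_apply A x = fun n => \sum_(0 <= k < m) A n k (x k)).
  by apply: (ideal_c0b_sum (u := fun k n => A n k (x k))) => // k; exact: AJ.
by apply/funext => n; case: (Ax n) => _ ->; rewrite /matrix_series seriesEnat.
Qed.

(** Test the matrix on the sequence whose only nonzero entry is [v], at
    position [k]. *)
Lemma matrix_class_column (R : realType) (X Y : completeNormedModType R)
    (I J : set (set nat)) (A : op_matrix X Y) (k : nat) (v : X) :
  is_ideal I -> matrix_class (ideal_c I) (ideal_c0b J) A ->
  ideal_c0b J (fun n => A n k v).
Proof.
move=> hI hA; pose x i : X := if i == k then v else 0.
have xI : ideal_c I x.
  apply: (@ideal_c_supported _ _ _ [set k]) => //.
    by apply: (ideal_finite hI); exact: finite_set1.
  by move=> i /= /eqP/negPf ik; rewrite /x ik.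
have [_] := hA _ xI; suff -> : matrix_apply A x = fun n => A n k v by [].
apply/funext => n.
have [|_ ->] := @matrix_series_eventually_zero _ _ _ A x n k.+1.
  by move=> i ki; rewrite /x gtn_eqF// linear0.
rewrite /matrix_series seriesEnat /= big_nat_recr//= /x eqxx big_nat_cond.
rewrite big1 ?add0r// => i /andP[/andP[_ ik] _].
by rewrite ltn_eqF// linear0.
Qed.

(** * Matrices acting on all sequences with a given support *)

(** The multiples of a nonzero value of [L] have arbitrarily large norm. *)
Lemma linear_shift_unbounded (R : realType) (X Y : normedModType R)
    (L : {linear X -> Y}) (y : Y) (c : R) :
  (exists v, L v <> 0) -> exists v, c <= `|y + L v|.
Proof.
move=> [v /eqP]; rewrite -normr_gt0 => Lv0.
pose t := (`|c| + `|y|) / `|L v|.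
have t0 : 0 <= t by rewrite divr_ge0// addr_ge0.
exists (t *: v); rewrite linearZ.
have : `|t *: L v| <= `|y + t *: L v| + `|y|.
  rewrite -[X in `|X| <= _](addrK y) [t *: _ + y]addrC.
  exact: ler_normB.
rewrite normrZ (ger0_norm t0) /t divfK ?gt_eqF// lerD2r.
exact/le_trans/ler_norm.
Qed.

(** If the row had infinitely many nonzero entries on [T], then [x] could be
    chosen on [T] so that infinitely many terms of the row
    series have norm at least [1]. *)
Lemma row_finite_on_support (R : realType) (X Y : completeNormedModType R)
    (A : op_matrix X Y) (T : set nat) (n : nat) :
  (forall x, (forall k, ~ T k -> x k = 0) -> cvgn (matrix_series A x n)) ->
  exists m, forall k, T k -> (m <= k)%N -> A n k =1 \0.
Proof.
move=> hA; apply: contrapT => noN.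
have val k : exists v : X, (~ T k -> v = 0) /\
    (T k -> (exists w, A n k w <> 0) -> 1 <= `|A n k v|).
  have [Tk|nTk] := pselect (T k); last by exists 0.
  have [ne0|e0] := pselect (exists w, A n k w <> 0); last by exists 0.
  have [v v1] := linear_shift_unbounded 0 1 ne0.
  by exists v; split=> // _ _; rewrite -[A n k v]add0r.
have [x xP] := choice val.
have /hA/cvg_series_cvg_0/cvgrPdist_lt/(_ _ ltr01)[m _ hm] :
  forall k, ~ T k -> x k = 0 by move=> k; case: (xP k).
apply: noN; exists m => k Tk mk w /=; apply: contrapT => Aw.
have := hm k mk; rewrite /= sub0r normrN ltNge.
by case: (xP k) => _ -> //; exists w.
Qed.

(** If [k] is the last index in [T] of a nonzero entry of row [r k], then for
    [x] supported in [T] the vector [A_{r k} x] is a finite sum ending at [k]: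
    the choice of [x_k] given the earlier entries decides its norm, and the
    later entries do not affect it. Making that norm at least [k] for all such
    [k] suffices, because such [k] are unbounded: a row with a nonzero entry at
    some index of [T] beyond [m] has its last one beyond [m] as well. *)
Lemma gliding_hump (R : realType) (X Y : completeNormedModType R)
    (A : op_matrix X Y) (T : set nat) :
  infinite_set T ->
  (forall k, T k -> exists n, exists v, A n k v <> 0) ->
  (forall n, exists m, forall k, T k -> (m <= k)%N -> A n k =1 \0) ->
  exists x, (forall k, ~ T k -> x k = 0) /\ ~ bounded_fun (matrix_apply A x).
Proof.
move=> Tinf col row.
pose last_in_row k n := [/\ T k, exists v, A n k v <> 0 &
  forall i, T i -> (k < i)%N -> A n i =1 \0].
pose L k := exists n, last_in_row k n.
have Lunbounded m : exists2 k, L k & (m <= k)%N.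
  have [k0 Tk0 mk0] := infinite_set_unbounded m Tinf.
  have [n nek0] := col _ Tk0; have [b bP] := row n.
  pose P k := `[< T k /\ exists v, A n k v <> 0 >].
  have exP : exists k, P k by exists k0; exact/asboolP.
  have ubP k : P k -> (k <= b)%N.
    move=> /asboolP[Tk [v Av]]; rewrite leqNgt; apply/negP => bk.
    by apply: Av; exact: bP (ltnW bk) _.
  case: (ex_maxnP exP ubP) => k /asboolP[Tk nek] kmax.
  exists k; last by apply: leq_trans mk0 (kmax _ _); exact/asboolP.
  exists n; split=> // i Ti ki v /=; apply: contrapT => Av.
  have /kmax : P i by apply/asboolP; split=> //; exists v.
  by rewrite leqNgt ki.
have rowof k : exists n, L k -> last_in_row k n.
  have [[n nP]|nL] := pselect (L k); first by exists n.
  by exists 0%N.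
have [r rP] := choice rowof.
(* [ky] pairs an index with the partial sum accumulated before it. *)
have hump (ky : nat * Y) : exists v : X, (~ L ky.1 -> v = 0) /\
    (L ky.1 -> ky.1%:R <= `|ky.2 + A (r ky.1) ky.1 v|).
  case: ky => k y /=; have [Lk|nLk] := pselect (L k); last by exists 0.
  have [_ ne0 _] := rP k Lk.
  have [v vP] := linear_shift_unbounded y k%:R ne0.
  by exists v.
have [f fP] := choice hump.
have [|x xE] := @course_of_values_rec _ (0 : X)
  (fun k x => f (k, matrix_series A x (r k) k)).
  move=> k g h gh; congr (f (k, _)); rewrite /matrix_series !seriesEnat /=.
  by apply: eq_big_nat => i /gh ->.
have x0 k : ~ T k -> x k = 0.
  move=> nTk; rewrite xE; case: (fP (k, matrix_series A x (r k) k)) => -> //=.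
  by move=> [n []].
exists x; split=> // /bounded_seqE[M AxM].
have [k Lk Mk] := Lunbounded (Num.truncn M).+1.
have [Tk _ lastk] := rP k Lk.
have : k%:R <= M.
  apply: le_trans (AxM (r k)).
  have [|_ ->] := @matrix_series_eventually_zero _ _ _ A x (r k) k.+1.
    move=> i ki; have [Ti|/x0 ->] := pselect (T i); last exact: linear0.
    exact: lastk.
  rewrite /matrix_series seriesSr [x k]xE.
  by case: (fP (k, matrix_series A x (r k) k)) => _; apply.
rewrite leNgt => /negP; apply.
by apply: lt_le_trans (truncnS_gt _) _; rewrite ler_nat.
Qed.

Theorem theorem2p18 (R : realType) (X Y : completeNormedModType R)
    (I J : set (set nat)) (hI : is_ideal I) (hJ : is_ideal J) (htall : tall I)
    (A : op_matrix X Y) :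
  matrix_class (ideal_c (V:=X) I) (ideal_c0b (V:=Y) J) A <->
  exists k1 : nat,
    [/\ forall n k : nat, (k1 <= k)%N -> A n k =1 \0,
        forall (x : X) (k : nat), (k < k1)%N ->
          (ereal_sup (range (fun n : nat => `|A n k x|%:E)) < +oo)%E
      & forall k : nat, (k < k1)%N -> strong_ideal_lim0 J (fun n => A n k)].
Proof.
split=> [hA|[k1 [A0 Abnd Alim]]]; last first.
  apply: (matrix_class_of_columns hJ A0) => k v kk1.
  by split; [exact/bounded_seq_ereal_sup/Abnd | exact: Alim].
have Acol k v := matrix_class_column k v hI hA.
suff [k1 A0] : exists k1, forall n k : nat, (k1 <= k)%N -> A n k =1 \0.
  exists k1; split=> // [v k _|k _ v]; last by case: (Acol k v).
  by apply/bounded_seq_ereal_sup; case: (Acol k v).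
apply: contrapT => noN.
have /htall[T [Tcol Tinf IT]] :
    infinite_set [set k | exists n, exists v, A n k v <> 0].
  move=> /finite_set_natP[m colm]; apply: noN; exists m => n k mk v /=.
  apply: contrapT => Av; suff /colm : [set k | exists n v, A n k v <> 0] k.
    by rewrite ltnNge mk.
  by exists n, v.
have hT x : (forall k, ~ T k -> x k = 0) ->
    (forall n, cvgn (matrix_series A x n)) /\ ideal_c0b J (matrix_apply A x).
  by move=> x0; apply: hA; exact: ideal_c_supported IT x0.
have [n|x [/hT[_ [Axbnd _]]]] := gliding_hump Tinf Tcol.
  by apply: row_finite_on_support => x /hT[].
exact.
Qed.
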